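(* Let $q$ be an odd prime power and let $Q$ be a nondegenerate quadratic form on $\mathbb{F}_q^d$. Let $P \subseteq \mathbb{F}_q^d$, and let $S$ be a set of $Q$-spheres (with arbitrary radii in $\mathbb{F}_q$, zero allowed). Then \[\left|I(P,S) - q^{-1}|P|\,|S|\right| \leq \sqrt{q^d|P|\,|S|}.\]
   Context: $\mathbb{F}_q$ is the finite field with $q$ elements. A quadratic form $Q(x) = \sum_{i,j} a_{ij}x_ix_j$ with $a_{ij}=a_{ji}$ is nondegenerate if the symmetric matrix $(a_{ij})$ is non-singular. The $Q$-sphere with center $y \in \mathbb{F}_q^d$ and radius $r \in \mathbb{F}_q$ is $\{x \in \mathbb{F}_q^d : Q(x-y) = r\}$; a sphere is specified by its center and radius. For $P \subseteq \mathbb{F}_q^d$ and a set $S$ of spheres, $I(P,S) = \#\{(x,s) \in P \times S : x \in s\}$. *)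

(* Defs.v *)
From HB Require Import structures.
From mathcomp Require Import all_boot all_order all_algebra.
Set Implicit Arguments.
Unset Strict Implicit.
Unset Printing Implicit Defensive.
Import GRing.Theory.
Local Open Scope ring_scope.

Definition quadratic_form (F : fieldType) (d : nat) (A : 'M[F]_d)
    (x : 'rV[F]_d) : F :=
  \sum_(i < d) \sum_(j < d) A i j * x 0 i * x 0 j.

(* When 2 is invertible in F, the symmetric matrix A is determined by Q. *)
Definition nondegenerate_quadratic_form (F : fieldType) (d : nat)
    (Q : 'rV[F]_d -> F) : Prop :=
  exists A : 'M[F]_d,
    [/\ A^T = A, A \in unitmx & forall x, Q x = quadratic_form A x].

(* A sphere is the pair (center, radius), not its point set: two distinct
   pairs count as two spheres even if they contain the same points. *)
Definition sphere (F : finFieldType) (d : nat) : finType :=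
  ('rV[F]_d * F)%type.

Definition sphere_points (F : finFieldType) (d : nat) (Q : 'rV[F]_d -> F)
    (s : sphere F d) : {set 'rV[F]_d} :=
  [set x | Q (x - s.1) == s.2].

Definition incidences (F : finFieldType) (d : nat) (Q : 'rV[F]_d -> F)
    (P : {set 'rV[F]_d}) (S : {set sphere F d}) : nat :=
  #|[set xs in setX P S | xs.1 \in sphere_points Q xs.2]|.

(* Main.v *)
Require Import Defs.
From HB Require Import structures.
From mathcomp Require Import all_boot all_order all_algebra.
From mathcomp Require Import ring.
Set Implicit Arguments.
Unset Strict Implicit.
Unset Printing Implicit Defensive.
Import Order.TTheory GRing.Theory Num.Theory.
Local Open Scope ring_scope.

(* For a point x and a sphere s put f x s := [x \in s] - 1/q.  Two distinct
   points x, x' are equidistant from exactly q^(d-1) centers y, because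
   Q (x - y) = Q (x' - y) is a nontrivial affine equation in y.  Hence the
   functions f x are pairwise orthogonal on the set of all q^(d+1) spheres, each
   with squared norm q^d - q^(d-1), and the theorem follows from the
   Cauchy-Schwarz inequality for \sum_(s in S) \sum_(x in P) f x s. *)

(** Cauchy-Schwarz against the constant 1. With [n = #|S|] and [t] the sum of [g], the sum of the
    squares [(n * g s - t) ^+ 2] equals [n] times the right side minus the left; the factor [n > 0]
    is then cancelled. *)
Lemma sqr_sum_le_card (R : realFieldType) (T : finType) (S : {set T})
    (g : T -> R) :
  (\sum_(s in S) g s) ^+ 2 <= #|S|%:R * \sum_(s in S) g s ^+ 2.
Proof.
set t := \sum_(s in S) g s.
have [S0|n0] := posnP #|S|.
  by rewrite S0 mul0r /t (cards0_eq S0) big_set0 expr0n.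
have n_gt0 : (0 : R) < #|S|%:R by rewrite ltr0n.
have: 0 <= \sum_(s in S) (#|S|%:R * g s - t) ^+ 2.
  by apply: sumr_ge0 => s _; apply: sqr_ge0.
have expand s : (#|S|%:R * g s - t) ^+ 2
    = #|S|%:R ^+ 2 * g s ^+ 2 - 2 * #|S|%:R * t * g s + t ^+ 2 by ring.
under eq_bigr => s _ do rewrite expand.
rewrite big_split sumrB -!mulr_sumr -/t sumr_const -[_ *+ #|S|]mulr_natl /=.
rewrite -[in X in _ -> X](ler_pM2l n_gt0) -[in X in _ -> X]subr_ge0.
by congr (0 <= _); ring.
Qed.

(** Translation by 1 permutes the ring, so adding 1 to every term leaves the sum of all elements
    unchanged. *)
Lemma natr_card_finNzRing (F : finNzRingType) : #|F|%:R = 0 :> F.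
Proof.
apply: (addrI (\sum_(x : F) x)); rewrite addr0.
rewrite [RHS](reindex_inj (addIr (1 : F))) big_split /=.
by rewrite sumr_const.
Qed.

Lemma odd_card_two_neq0 (F : finNzRingType) : odd #|F| -> 2%:R != 0 :> F.
Proof.
move=> hodd; apply/eqP => two0; have := natr_card_finNzRing F.
rewrite -(odd_double_half #|F|) hodd -muln2 natrD natrM two0 mulr0 addr0.
exact/eqP/oner_neq0.
Qed.

(** Translations along a vector [u] with [u *m v = 1] carry the level sets of [y *m v] onto one
    another, so these [#|F|] sets split the space equally. The product form avoids the exponent
    [d - 1], truncated at [d = 0]. *)
Lemma card_hyperplane (F : finFieldType) (d : nat) (v : 'cV[F]_d) (c : F) :
  v != 0 -> (#|[set y : 'rV[F]_d | ((y *m v) 0 0 == c)%R]| * #|F| = #|F| ^ d)%N.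
Proof.
move=> v0; have [i vi0] : exists i, v i 0 != 0.
  by apply/cV0Pn.
pose u : 'rV[F]_d := (v i 0)^-1 *: delta_mx 0 i.
have uv : (u *m v) 0 0 = 1.
  by rewrite -scalemxAl -rowE !mxE mulVf.
have translate z b : ((b *: u + z) *m v) 0 0 = b + (z *m v) 0 0.
  by rewrite mulmxDl -scalemxAl mxE [X in X + _]mxE uv mulr1.
have fiber a : #|[set y : 'rV[F]_d | (y *m v) 0 0 == a]|
    = #|[set y : 'rV[F]_d | (y *m v) 0 0 == c]|.
  rewrite -(card_imset _ (@addrI _ ((c - a) *: u))); apply: eq_card => y.
  rewrite inE; apply/imsetP/eqP => [[z]|yc].
    by rewrite inE => /eqP za ->; rewrite translate za subrK.
  exists ((a - c) *: u + y).
    by rewrite inE translate yc subrK.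
  by rewrite addrA -scalerDl subrKA subrr scale0r add0r.
have := card_mx F 1 d; rewrite mul1n => <-.
rewrite -[RHS]sum1_card.
rewrite (partition_big (fun y : 'rV[F]_d => (y *m v) 0 0) predT) //=.
under eq_bigr => a _ do rewrite sum1dep_card fiber.
by rewrite sum_nat_const mulnC.
Qed.

Lemma quadratic_formE (F : fieldType) (d : nat) (A : 'M[F]_d) (x : 'rV[F]_d) :
  quadratic_form A x = (x *m A *m x^T) 0 0.
Proof.
rewrite mxE /quadratic_form exchange_big; apply: eq_bigr => j _.
rewrite !mxE mulr_suml; apply: eq_bigr => i _; ring.
Qed.

Lemma quadratic_formB (F : fieldType) (d : nat) (A : 'M[F]_d)
    (x y : 'rV[F]_d) : A^T = A ->
  quadratic_form A (x - y)
  = quadratic_form A x - 2%:R * (y *m (A *m x^T)) 0 0 + quadratic_form A y.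
Proof.
move=> symA; rewrite !quadratic_formE.
have addE (M N : 'M[F]_1) : (M + N) 0 0 = M 0 0 + N 0 0 by rewrite mxE.
have oppE (M : 'M[F]_1) : (- M) 0 0 = - M 0 0 by rewrite mxE.
(* A 1 by 1 matrix equals its transpose, so symmetry of [A] merges the two cross terms. *)
have xAy : (x *m A *m y^T) 0 0 = (y *m A *m x^T) 0 0.
  by rewrite -[x *m A *m y^T]trmxK [LHS]mxE !trmx_mul trmxK symA mulmxA.
rewrite linearB /= !(mulmxBl, mulmxBr) !(addE, oppE) xAy mulmxA; ring.
Qed.

Lemma card_equidistant (F : finFieldType) (d : nat) (A : 'M[F]_d)
    (x x' : 'rV[F]_d) :
  odd #|F| -> A^T = A -> A \in unitmx -> x != x' ->
  (#|[set y | (quadratic_form A (x - y) == quadratic_form A (x' - y))%R]| * #|F|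
   = #|F| ^ d)%N.
Proof.
move=> hodd symA unitA neq_xx'; have two0 := odd_card_two_neq0 hodd.
have v0 : A *m (x - x')^T != 0.
  apply: contra_neq neq_xx' => Axx'0; apply/eqP; rewrite -subr_eq0 -trmx_eq0.
  by rewrite -(mulKmx unitA (x - x')^T) Axx'0 mulmx0.
(* The terms quadratic in [y] cancel, leaving [2 * (y *m v) = Q x - Q x'] with
   [v = A *m (x - x')^T]; hence the division by 2. *)
pose c := (quadratic_form A x - quadratic_form A x') / 2%:R.
rewrite -(card_hyperplane c v0); congr (_ * _)%N; apply: eq_card => y.
rewrite !inE !quadratic_formB // (inj_eq (addIr _)) linearB /= !mulmxBr.
rewrite [X in _ = (X == c)]mxE [X in _ = (_ + X == c)]mxE /c.
rewrite eq_sym -subr_eq0 -[in RHS]subr_eq0.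
rewrite -[in RHS](mulrI_eq0 _ (lregP two0)).
by congr (_ == 0); field.
Qed.

Lemma incidencesE (F : finFieldType) (d : nat) (Q : 'rV[F]_d -> F)
    (P : {set 'rV[F]_d}) (S : {set sphere F d}) :
  incidences Q P S
  = (\sum_(s in S) \sum_(x in P) (x \in sphere_points Q s))%N.
Proof.
rewrite /incidences -sum1dep_card exchange_big /= pair_big_dep /= big_mkcondr.
by apply: eq_big => [[x s]|[x s] _] /=; rewrite ?in_setX.
Qed.

(** Once the center [y] is chosen, passing through [x] forces the radius [Q (x - y)]. *)
Lemma card_spheres_through2 (F : finFieldType) (d : nat) (Q : 'rV[F]_d -> F)
    (x x' : 'rV[F]_d) :
  (\sum_(s : sphere F d) (x \in sphere_points Q s) * (x' \in sphere_points Q s)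
   = #|[set y | (Q (x - y) == Q (x' - y))%R]|)%N.
Proof.
rewrite -(pair_bigA_idem _ (fun y r =>
  (x \in sphere_points Q (y, r)) * (x' \in sphere_points Q (y, r)))%N) //=.
rewrite -sum1_card [RHS]big_mkcond /=; apply: eq_bigr => y _.
rewrite (bigD1 (Q (x - y))) //= big1 => [|r]; last first.
  by rewrite !inE eq_sym => /negbTE ->.
by rewrite !inE eqxx addn0 mul1n eq_sym; case: eqP.
Qed.

(** Expanding the product gives the number of spheres through both points, minus [2 * q ^+ d / q],
    plus [q ^+ d / q] from the [q ^ (d + 1)] constant terms. That number is [q ^ d] on the diagonal
    and [q ^ d / q] off it. *)
Lemma sphere_orthogonality (R : numFieldType) (F : finFieldType) (d : nat)
    (A : 'M[F]_d) (x x' : 'rV[F]_d) :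
  odd #|F| -> A^T = A -> A \in unitmx ->
  \sum_(s : sphere F d)
     ((x \in sphere_points (quadratic_form A) s)%:R - #|F|%:R^-1) *
     ((x' \in sphere_points (quadratic_form A) s)%:R - #|F|%:R^-1)
  = (if x == x' then #|F|%:R ^+ d - #|F|%:R ^+ d / #|F|%:R else 0) :> R.
Proof.
move=> hodd symA unitA; set Q := quadratic_form A; set q : R := #|F|%:R.
have q0 : q != 0 by rewrite pnatr_eq0 -lt0n; case: #|F| hodd.
have card_rV : #|{: 'rV[F]_d}| = (#|F| ^ d)%N by rewrite card_mx mul1n.
(* Each center carries exactly one sphere through [z]: this is the two-point count with both points
   equal to [z]. *)
have through z : \sum_(s : sphere F d) (z \in sphere_points Q s)%:R = q ^+ d.
  rewrite -natrX -card_rV -cardsT -natr_sum; congr _%:R.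
  transitivity #|[set y | Q (z - y) == Q (z - y)]|.
    by rewrite -card_spheres_through2; apply: eq_bigr => s _; case: (_ \in _).
  by apply: eq_card => y; rewrite !inE eqxx.
have expand s : ((x \in sphere_points Q s)%:R - q^-1)
      * ((x' \in sphere_points Q s)%:R - q^-1)
    = ((x \in sphere_points Q s) * (x' \in sphere_points Q s))%:R
      - q^-1 * (x \in sphere_points Q s)%:R
      - q^-1 * (x' \in sphere_points Q s)%:R + q^-1 ^+ 2.
  by rewrite natrM; ring.
under eq_bigr => s _ do rewrite expand.
rewrite big_split !sumrB -!mulr_sumr !through sumr_const -natr_sum /=.
rewrite card_spheres_through2 card_prod card_rV.
rewrite -[q^-1 *+ _]mulr_natr natrM natrX -/q.
case: eqVneq => [<-|neq_xx'].
  have -> : #|[set y | Q (x - y) == Q (x - y)]| = (#|F| ^ d)%N.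
    by rewrite -card_rV -cardsT; apply: eq_card => y; rewrite !inE eqxx.
  by rewrite natrX -/q; field.
have := congr1 (fun n => n%:R : R) (card_equidistant hodd symA unitA neq_xx').
rewrite natrM natrX -/q -/Q => /(canRL (mulfK q0)) ->.
by field.
Qed.

Lemma sphere_second_moment (R : numFieldType) (F : finFieldType) (d : nat)
    (A : 'M[F]_d) (P : {set 'rV[F]_d}) :
  odd #|F| -> A^T = A -> A \in unitmx ->
  \sum_(s : sphere F d)
     (\sum_(x in P)
        ((x \in sphere_points (quadratic_form A) s)%:R - #|F|%:R^-1)) ^+ 2
  = #|P|%:R * (#|F|%:R ^+ d - #|F|%:R ^+ d / #|F|%:R) :> R.
Proof.
move=> hodd symA unitA.
under eq_bigr => s _.
  rewrite expr2 big_distrlr /=; over.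
rewrite exchange_big [RHS]mulr_natl -[RHS]sumr_const /=; apply: eq_bigr => x Px.
rewrite exchange_big /=.
under eq_bigr => x' _ do rewrite sphere_orthogonality //.
rewrite (bigD1 x) //= eqxx big1 ?addr0 // => x' /andP[_].
by rewrite eq_sym => /negbTE ->.
Qed.

Theorem theorem2p2 (R : rcfType) (F : finFieldType) (q d : nat)
    (hq : #|F| = q) (hodd : odd q)
    (Q : 'rV[F]_d -> F) (hQ : nondegenerate_quadratic_form Q)
    (P : {set 'rV[F]_d}) (S : {set sphere F d}) :
  `|(incidences Q P S)%:R - q%:R^-1 * #|P|%:R * #|S|%:R|
    <= Num.sqrt (q%:R ^+ d * #|P|%:R * #|S|%:R) :> R.
Proof.
case: hQ => A [symA unitA QE].
have -> : incidences Q P S = incidences (quadratic_form A) P S.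
  by apply: eq_card => -[x s]; rewrite !inE QE.
rewrite -{}hq in hodd *.
pose g s : R := \sum_(x in P)
  ((x \in sphere_points (quadratic_form A) s)%:R - #|F|%:R^-1).
have -> : (incidences (quadratic_form A) P S)%:R
    - #|F|%:R^-1 * #|P|%:R * #|S|%:R = \sum_(s in S) g s.
  rewrite incidencesE natr_sum.
  under [RHS]eq_bigr => s _ do rewrite /g sumrB sumr_const.
  rewrite sumrB sumr_const -[_^-1 *+ _]mulr_natr -[_ * _ *+ #|S|]mulr_natr.
  by congr (_ - _); apply: eq_bigr => s _; rewrite natr_sum.
rewrite -sqrtr_sqr; apply: ler_wsqrtr.
apply: le_trans (sqr_sum_le_card S g) _; rewrite mulrC ler_wpM2r //.
have moment := sphere_second_moment R P hodd symA unitA.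
(* Squares are nonnegative, so the sum may be enlarged from [S] to all spheres, where the second
   moment is known exactly. *)
apply: (@le_trans _ _ (\sum_s g s ^+ 2)).
  rewrite [leLHS]big_mkcond; apply: ler_sum => s _.
  by case: ifP => _ //; apply: sqr_ge0.
(* Dropping the subtracted [q ^+ d / q] leaves the stated bound. *)
rewrite moment [leRHS]mulrC ler_wpM2l // gerBl.
by rewrite divr_ge0 ?exprn_ge0.
Qed.
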